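(* Let $x$ be a rational number with Hirzebruch-Jung continued fraction expansion $x=\llbracket c_1,c_2,\ldots,c_N\rrbracket$. If all the coefficients $c_1,\ldots,c_N$ are larger than $3$, then the radius of convergence of $[x]_q$ (the Taylor series at $q=0$ of the $q$-deformed rational $[x]_q$, with $q$ a complex variable) is greater than $R_\star=\frac{3-\sqrt5}{2}$.
   Context: For an integer $c\ge 1$ let $[c]_q = 1+q+\cdots+q^{c-1}$. Every rational $x>0$ has a unique finite Hirzebruch-Jung continued fraction expansion $$x=\llbracket c_1,\ldots,c_N\rrbracket := c_1-\cfrac{1}{c_2-\cfrac{1}{\ddots-\cfrac{1}{c_N}}},$$ with integers $c_1\ge 1$ and $c_j\ge 2$ for $j\ge 2$. The $q$-deformation of $x$ is the rational function $$[x]_q := [c_1]_q-\cfrac{q^{c_1-1}}{[c_2]_q-\cfrac{q^{c_2-1}}{\ddots-\cfrac{q^{c_{N-1}-1}}{[c_N]_q}}}.$$ (Equivalently, $x\mapsto [x]_q$ is the unique map on rationals with $[0]_q=0$, $[x+1]_q=q[x]_q+1$ and $[-1/x]_q=-1/(q[x]_q)$.) The function $[x]_q$ is regular at $q=0$; the radius of convergence of its Taylor series at $q=0$ is an element of $(0,+\infty]$ ($+\infty$ if $[x]_q$ is a polynomial). *)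

(* Defs.v *)
From Stdlib Require Import Reals QArith ZArith Lia Lqa ClassicalEpsilon.
From Coquelicot Require Import Coquelicot.
From Stdlib Require Import List.
Import ListNotations.

(* The empty list is not an expansion; its value is a dummy. *)
Fixpoint HJ_value (c : list nat) : Q :=
  match c with
  | nil => 0
  | c1 :: nil => inject_Z (Z.of_nat c1)
  | c1 :: cs => inject_Z (Z.of_nat c1) - / HJ_value cs
  end%Q.

Definition HJ_admissible (c : list nat) : Prop :=
  match c with
  | nil => False
  | c1 :: cs => (1 <= c1)%nat /\ Forall (fun k => (2 <= k)%nat) cs
  end.

Definition is_HJ_expansion (x : Q) (c : list nat) : Prop :=
  HJ_admissible c /\ (x == HJ_value c)%Q.

(* Existence (for [x > 0]) and uniqueness are proved below;
   for [x <= 0] the value is arbitrary. *)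
Definition HJ_expansion (x : Q) : list nat :=
  epsilon (inhabits nil) (is_HJ_expansion x).

Fixpoint q_int (c : nat) (q : C) : C :=
  match c with
  | O => 0
  | S n => q_int n q + q ^ n
  end%C.

(* Pointwise evaluation at [q : C], with the total division of [C].  For an
   admissible expansion every denominator equals 1 at [q = 0], so near 0 this
   is the value of the rational function and its Taylor series at 0 does not
   depend on the convention for division by zero. *)
Fixpoint HJ_q (c : list nat) (q : C) : C :=
  match c with
  | nil => 0
  | c1 :: nil => q_int c1 q
  | c1 :: cs => q_int c1 q - q ^ (c1 - 1) / HJ_q cs q
  end%C.

Definition q_rational (x : Q) : C -> C := HJ_q (HJ_expansion x).

(* [C_derive] is a limit of difference quotients along the real direction only;
   it is the complex derivative wherever that exists ([is_C_derive_unique]),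
   hence at every point near 0 for the functions considered here. *)
Fixpoint C_derive_n (f : C -> C) (n : nat) : C -> C :=
  match n with
  | O => f
  | S m => C_derive (C_derive_n f m)
  end.

Definition taylor_coef (f : C -> C) (n : nat) : C :=
  (C_derive_n f n 0 / INR (fact n))%C.

(* Complex counterpart of [CV_radius], which only treats real coefficients. *)
Definition C_CV_radius (a : nat -> C) : Rbar :=
  Lub_Rbar (fun r : R => exists q : C,
    r = Cmod q /\ @ex_pseries C_AbsRing C_NormedModule a q).

Definition R_star : R := ((3 - sqrt 5) / 2)%R.

Local Open Scope Q_scope.

Lemma HJ_value_cons (c1 c2 : nat) (cs : list nat) :
  HJ_value (c1 :: c2 :: cs) =
  inject_Z (Z.of_nat c1) - / HJ_value (c2 :: cs).
Proof. reflexivity. Qed.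

Lemma inject_Z_of_nat_le (m n : nat) :
  (m <= n)%nat -> inject_Z (Z.of_nat m) <= inject_Z (Z.of_nat n).
Proof. intros H; rewrite <- Zle_Qle; lia. Qed.

Lemma Qinv_lt_1 (y : Q) : 1 < y -> 0 < / y /\ / y < 1.
Proof.
intros Hy.
assert (P : 0 < / y) by (apply Qinv_lt_0_compat; lra).
split; [exact P|].
assert (E : y * / y == 1) by (apply Qmult_inv_r; intros K; lra).
nra.
Qed.

Lemma HJ_value_gt1 (c : list nat) :
  c <> nil -> Forall (fun k => (2 <= k)%nat) c -> 1 < HJ_value c.
Proof.
induction c as [|c1 [|c2 cs] IH]; intros Hn Hc; [easy| |].
- inversion Hc as [|? ? H _]; subst.
  pose proof (inject_Z_of_nat_le 2 c1 H) as H'.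
  change (inject_Z (Z.of_nat 2)) with 2 in H'. cbn [HJ_value]. lra.
- inversion Hc as [|? ? H Hcs]; subst.
  pose proof (inject_Z_of_nat_le 2 c1 H) as H'.
  change (inject_Z (Z.of_nat 2)) with 2 in H'.
  destruct (Qinv_lt_1 _ (IH ltac:(discriminate) Hcs)).
  rewrite HJ_value_cons. lra.
Qed.

Lemma HJ_value_bounds (c1 : nat) (cs : list nat) :
  Forall (fun k => (2 <= k)%nat) cs ->
  inject_Z (Z.of_nat c1) - 1 < HJ_value (c1 :: cs) /\
  HJ_value (c1 :: cs) <= inject_Z (Z.of_nat c1) /\
  (cs <> nil -> HJ_value (c1 :: cs) < inject_Z (Z.of_nat c1)).
Proof.
intros Hcs; destruct cs as [|c2 cs].
- cbn [HJ_value]; repeat split; try lra. intros K; now elim K.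
- destruct (Qinv_lt_1 _ (HJ_value_gt1 (c2 :: cs) ltac:(discriminate) Hcs)).
  rewrite HJ_value_cons; repeat split; intros; lra.
Qed.

Lemma HJ_value_inj (c d : list nat) :
  HJ_admissible c -> HJ_admissible d -> HJ_value c == HJ_value d -> c = d.
Proof.
revert d; induction c as [|c1 cs IH]; intros [|d1 ds]; try easy.
intros [Hc1 Hcs] [Hd1 Hds] E.
destruct (HJ_value_bounds c1 cs Hcs) as (A1 & A2 & A3).
destruct (HJ_value_bounds d1 ds Hds) as (B1 & B2 & B3).
assert (E1 : c1 = d1).
{ assert (L : inject_Z (Z.of_nat c1) < inject_Z (Z.of_nat d1 + 1)).
  { rewrite inject_Z_plus. change (inject_Z 1) with 1. lra. }
  assert (L' : inject_Z (Z.of_nat d1) < inject_Z (Z.of_nat c1 + 1)).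
  { rewrite inject_Z_plus. change (inject_Z 1) with 1. lra. }
  rewrite <- Zlt_Qlt in L, L'. lia. }
subst d1; f_equal.
destruct cs as [|c2 cs], ds as [|d2 ds]; [easy | | |].
- exfalso. specialize (B3 ltac:(discriminate)). cbn [HJ_value] in E, B3. lra.
- exfalso. specialize (A3 ltac:(discriminate)). cbn [HJ_value] in E, A3. lra.
- apply IH.
  + inversion Hcs; subst. split; [lia | assumption].
  + inversion Hds; subst. split; [lia | assumption].
  + rewrite !HJ_value_cons in E.
    assert (I : / HJ_value (c2 :: cs) == / HJ_value (d2 :: ds)) by lra.
    rewrite <- (Qinv_involutive (HJ_value (c2 :: cs))), I.
    apply Qinv_involutive.
Qed.

Lemma is_HJ_expansion_unique (x : Q) (c d : list nat) :
  is_HJ_expansion x c -> is_HJ_expansion x d -> c = d.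
Proof.
intros [Hc Ec] [Hd Ed]; apply HJ_value_inj; auto.
now rewrite <- Ec.
Qed.

Lemma is_HJ_expansion_ex (x : Q) :
  0 < x -> exists c : list nat, is_HJ_expansion x c.
Proof.
assert (H : forall (n : nat) (p q : Z), (0 < p)%Z -> (0 < q <= Z.of_nat n)%Z ->
  exists c, is_HJ_expansion (inject_Z p / inject_Z q) c).
{ induction n as [|n IH]; intros p q Hp Hq; [lia|].
  set (k := ((p + q - 1) / q)%Z). set (r := (k * q - p)%Z).
  assert (Hr : (0 <= r < q)%Z).
  { pose proof (Z.div_mod (p + q - 1) q ltac:(lia)).
    pose proof (Z.mod_pos_bound (p + q - 1) q ltac:(lia)).
    unfold r, k. nia. }
  assert (Hk : (1 <= k)%Z) by (unfold r in Hr; nia).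
  assert (Nq : ~ inject_Z q == 0).
  { change 0 with (inject_Z 0). rewrite inject_Z_injective. lia. }
  assert (Ek : inject_Z (Z.of_nat (Z.to_nat k)) = inject_Z k)
    by now rewrite Z2Nat.id by lia.
  destruct (Z.eq_dec r 0) as [R0 | R0].
  - exists [Z.to_nat k]. split; [split; [lia | constructor]|].
    cbn [HJ_value]. rewrite Ek.
    replace p with (k * q)%Z by (unfold r in R0; lia).
    rewrite inject_Z_mult. field. exact Nq.
  - destruct (IH q r ltac:(lia) ltac:(lia)) as [[|c1 cs] [Ha Hv]]; [easy|].
    assert (Nr : ~ inject_Z r == 0).
    { change 0 with (inject_Z 0). rewrite inject_Z_injective. lia. }
    destruct Ha as [Hc1 Hcs].
    assert (Hc1' : (2 <= c1)%nat).
    { destruct (HJ_value_bounds c1 cs Hcs) as (_ & B & _).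
      assert (Hlt : 1 < inject_Z q / inject_Z r).
      { apply Qlt_shift_div_l.
        - change 0 with (inject_Z 0). rewrite <- Zlt_Qlt. lia.
        - rewrite Qmult_1_l, <- Zlt_Qlt. lia. }
      assert (L : inject_Z 1 < inject_Z (Z.of_nat c1)).
      { change (inject_Z 1) with 1. lra. }
      rewrite <- Zlt_Qlt in L. lia. }
    exists (Z.to_nat k :: c1 :: cs). split.
    + split; [lia | now constructor].
    + rewrite HJ_value_cons, <- Hv, Ek.
      replace p with (k * q - r)%Z by (unfold r; lia).
      unfold Z.sub. rewrite inject_Z_plus, inject_Z_mult, inject_Z_opp.
      field. split; assumption. }
intros Hx. destruct x as [p q].
assert (Hp : (0 < p)%Z) by (unfold Qlt in Hx; simpl in Hx; lia).
destruct (H (Pos.to_nat q) p (Zpos q) Hp ltac:(lia)) as [c [Ha Hv]].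
exists c; split; [exact Ha|]. now rewrite Qmake_Qdiv.
Qed.

Lemma HJ_expansion_eq (x : Q) (c : list nat) :
  is_HJ_expansion x c -> HJ_expansion x = c.
Proof.
intros Hc. apply (is_HJ_expansion_unique x); [|exact Hc].
unfold HJ_expansion. apply epsilon_spec. now exists c.
Qed.

(* Main.v *)
(* With r = 2/5 > R_star, the functions whose Taylor coefficients satisfy
   sum |a_n| r^n <= B form a Banach algebra, in which 1/(1 - u) has norm at most
   1/(1 - |u|).  If y = [c]_q - q^(c-1) z', where z' is the inverse of the next
   denominator (0 if there is none), then (1 - q) y = 1 - u with
   u = q^c + (1 - q) q^(c-1) z'.  For c >= 4 a bound |z'| <= 7/4 therefore gives
   |1/y| <= (1 + r) / (1 - r^4 - 7/4 (1 + r) r^3) < 7/4, so the bound propagates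
   along the continued fraction, and [x]_q itself converges absolutely at r. *)
Require Import Defs.
From Stdlib Require Import Reals QArith.
From Coquelicot Require Import Coquelicot.
From Stdlib Require Import List.
From Stdlib Require Import Lra Lia.

Local Open Scope R_scope.

(** * Weighted absolute sums of real coefficient sequences *)

Lemma ex_series_bounded_sums (a : nat -> R) (B : R) :
  (forall n, 0 <= a n) -> (forall N, sum_f_R0 a N <= B) -> ex_series a.
Proof.
intros Ha HB.
assert (L : ex_finite_lim_seq (sum_n a)).
{ apply ex_finite_lim_seq_incr with B.
  - intros n. rewrite sum_Sn. change (sum_n a n <= sum_n a n + a (S n)).
    specialize (Ha (S n)). lra.
  - intros n. rewrite sum_n_Reals. apply HB. }
destruct L as [l Hl]. exists l. exact Hl.
Qed.

(** Bounding every partial sum encodes both convergence and the norm bound, and lets estimates be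
    proved before convergence is known. *)
Definition weighted_sums_le (r : R) (a : nat -> R) (B : R) : Prop :=
  forall N, sum_f_R0 (fun n => Rabs (a n) * r ^ n) N <= B.

Lemma weighted_term_ge0 (r : R) (a : nat -> R) (n : nat) :
  0 <= r -> 0 <= Rabs (a n) * r ^ n.
Proof. intros Hr. apply Rmult_le_pos; [apply Rabs_pos | now apply pow_le]. Qed.

Lemma weighted_sums_ge0 (r : R) (a : nat -> R) (B : R) :
  0 <= r -> weighted_sums_le r a B -> 0 <= B.
Proof.
intros Hr HB. specialize (HB 0%nat). cbn in HB.
pose proof (Rabs_pos (a 0%nat)). lra.
Qed.

Lemma weighted_sums_CV_disk (r : R) (a : nat -> R) (B : R) :
  0 <= r -> weighted_sums_le r a B -> CV_disk a r.
Proof.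
intros Hr HB. unfold CV_disk.
apply ex_series_ext with (a := fun n => Rabs (a n) * r ^ n).
- intros n. rewrite Rabs_mult, (Rabs_pos_eq (r ^ n)); [reflexivity | now apply pow_le].
- apply ex_series_bounded_sums with B; [|exact HB].
  intros n; now apply weighted_term_ge0.
Qed.

Lemma weighted_sums_CV_radius (r : R) (a : nat -> R) (B t : R) :
  weighted_sums_le r a B -> Rabs t < r -> Rbar_lt (Rabs t) (CV_radius a).
Proof.
intros HB Ht. pose proof (Rabs_pos t).
apply Rbar_lt_le_trans with r; [exact Ht|].
apply (proj1 (Lub_Rbar_correct (CV_disk a))).
apply weighted_sums_CV_disk with B; [lra | exact HB].
Qed.

(** The left side sums [A i * B j] over the triangle i + j <= N, the right side over the whole
    square; the remaining terms are nonnegative. *)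
Lemma sum_f_R0_mult_conv_le (A B : nat -> R) (N : nat) :
  (forall n, 0 <= A n) -> (forall n, 0 <= B n) ->
  sum_f_R0 (fun n => sum_f_R0 (fun k => A k * B (n - k)%nat) n) N <=
  sum_f_R0 A N * sum_f_R0 B N.
Proof.
intros HA HB. destruct N as [|N]; [cbn; lra|].
rewrite (cauchy_finite A B (S N)) by lia.
match goal with |- _ <= _ + ?x => assert (0 <= x) end.
{ apply cond_pos_sum; intros k. apply cond_pos_sum; intros l.
  now apply Rmult_le_pos. }
lra.
Qed.

Lemma weighted_PS_mult_le (r : R) (a b : nat -> R) (N : nat) :
  0 <= r ->
  sum_f_R0 (fun n => Rabs (PS_mult a b n) * r ^ n) N <=
  sum_f_R0 (fun n => Rabs (a n) * r ^ n) N *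
  sum_f_R0 (fun n => Rabs (b n) * r ^ n) N.
Proof.
intros Hr.
eapply Rle_trans;
  [|apply sum_f_R0_mult_conv_le; intros; now apply weighted_term_ge0].
apply sum_Rle; intros n _. unfold PS_mult.
eapply Rle_trans.
- apply Rmult_le_compat_r; [now apply pow_le | apply Rsum_abs].
- rewrite Rmult_comm, scal_sum. right. apply sum_eq; intros k Hk.
  rewrite Rabs_mult. replace (r ^ n) with (r ^ k * r ^ (n - k)).
  + ring.
  + rewrite <- pow_add. f_equal. lia.
Qed.

(** * Functions with a power series of bounded weighted norm: ring operations and inversion of 1 -
    u *)

Definition PS_const (k : R) (n : nat) : R :=
  match n with O => k | S _ => 0 end.

Lemma PSeries_PS_const (k t : R) : PSeries (PS_const k) t = k.
Proof.
apply is_pseries_unique.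
apply filterlim_ext with (fun _ : nat => k); [|apply filterlim_const].
intros n. rewrite sum_n_Reals.
induction n as [|n IH]; cbn [sum_f_R0].
- unfold scal; cbn. unfold mult; cbn. ring.
- rewrite <- IH. unfold scal; cbn. unfold mult; cbn. ring.
Qed.

Lemma weighted_PS_const (r k : R) : weighted_sums_le r (PS_const k) (Rabs k).
Proof.
intros N; induction N as [|N IH]; cbn [sum_f_R0 PS_const] in *.
- rewrite pow_O. lra.
- rewrite Rabs_R0. lra.
Qed.

(* Coquelicot's [C_derive] only sees the values on a line parallel to the real
   axis, and the Taylor coefficients at hand are real, so it is enough to
   describe [F] on the real segment. *)
Definition expands_within (r : R) (F : C -> C) (B : R) : Prop :=
  exists a, weighted_sums_le r a B /\
    forall t, Rabs t < r -> F (RtoC t) = RtoC (PSeries a t).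

Lemma expands_within_ext (r : R) (F G : C -> C) (B : R) :
  (forall t, Rabs t < r -> F (RtoC t) = G (RtoC t)) ->
  expands_within r F B -> expands_within r G B.
Proof.
intros E (a & Ha & Sa). exists a; split; [exact Ha|].
intros t Ht. now rewrite <- E, Sa.
Qed.

Lemma expands_within_le (r : R) (F : C -> C) (B B' : R) :
  B <= B' -> expands_within r F B -> expands_within r F B'.
Proof.
intros L (a & Ha & Sa). exists a; split; [|exact Sa].
intros N. specialize (Ha N). lra.
Qed.

Lemma expands_within_const (r k : R) :
  expands_within r (fun _ => RtoC k) (Rabs k).
Proof.
exists (PS_const k); split; [apply weighted_PS_const|].
intros t _. now rewrite PSeries_PS_const.
Qed.

Lemma expands_within_id (r : R) :
  0 <= r -> expands_within r (fun q => q) r.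
Proof.
intros Hr. exists (PS_incr_1 (PS_const 1)); split.
- intros N. induction N as [|[|N] IH]; cbn [sum_f_R0 PS_incr_1 PS_const] in *.
  + unfold zero; cbn. rewrite Rabs_R0. lra.
  + unfold zero; cbn. rewrite Rabs_R0, Rabs_R1. lra.
  + rewrite (Rabs_R0). lra.
- intros t _. now rewrite PSeries_incr_1, PSeries_PS_const, Rmult_1_r.
Qed.

Lemma expands_within_plus (r : R) (F G : C -> C) (A B : R) :
  0 <= r -> expands_within r F A -> expands_within r G B ->
  expands_within r (fun q => F q + G q)%C (A + B).
Proof.
intros Hr (a & Ha & Sa) (b & Hb & Sb).
exists (PS_plus a b). split.
- intros N.
  eapply Rle_trans; [|apply Rplus_le_compat; [exact (Ha N) | exact (Hb N)]].
  rewrite <- sum_plus. apply sum_Rle; intros n _.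
  rewrite <- Rmult_plus_distr_r.
  apply Rmult_le_compat_r; [now apply pow_le | apply Rabs_triang].
- intros t Ht. rewrite Sa, Sb by exact Ht. rewrite <- RtoC_plus, PSeries_plus.
  + reflexivity.
  + apply CV_radius_inside. now apply weighted_sums_CV_radius with r A.
  + apply CV_radius_inside. now apply weighted_sums_CV_radius with r B.
Qed.

Lemma expands_within_mult (r : R) (F G : C -> C) (A B : R) :
  0 <= r -> expands_within r F A -> expands_within r G B ->
  expands_within r (fun q => F q * G q)%C (A * B).
Proof.
intros Hr (a & Ha & Sa) (b & Hb & Sb).
exists (PS_mult a b). split.
- intros N. eapply Rle_trans; [now apply weighted_PS_mult_le|].
  apply Rmult_le_compat; [| |exact (Ha N)|exact (Hb N)];
    apply cond_pos_sum; intros n; now apply weighted_term_ge0.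
- intros t Ht. rewrite Sa, Sb by exact Ht. rewrite <- RtoC_mult, PSeries_mult.
  + reflexivity.
  + now apply weighted_sums_CV_radius with r A.
  + now apply weighted_sums_CV_radius with r B.
Qed.

Lemma expands_within_minus (r : R) (F G : C -> C) (A B : R) :
  0 <= r -> expands_within r F A -> expands_within r G B ->
  expands_within r (fun q => F q - G q)%C (A + B).
Proof.
intros Hr HF HG.
apply expands_within_ext with (fun q => F q + RtoC (- (1)) * G q)%C.
- intros t _. rewrite RtoC_opp. ring.
- replace (A + B) with (A + Rabs (- (1)) * B)
    by (rewrite Rabs_Ropp, Rabs_R1; ring).
  apply expands_within_plus, expands_within_mult; auto.
  apply expands_within_const.
Qed.

Lemma expands_within_pow (r : R) (n : nat) :
  0 <= r -> expands_within r (fun q => q ^ n)%C (r ^ n).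
Proof.
intros Hr. induction n as [|n IH].
- cbn [pow]. rewrite <- Rabs_R1. apply expands_within_const.
- apply (expands_within_mult r (fun q => q) (fun q => q ^ n)%C); auto.
  now apply expands_within_id.
Qed.

Lemma expands_within_q_int (r : R) (c : nat) :
  0 <= r -> exists B, expands_within r (q_int c) B.
Proof.
intros Hr. induction c as [|c [B IH]].
- exists (Rabs 0). apply expands_within_const.
- exists (B + r ^ c). apply (expands_within_plus r (q_int c)); auto.
  now apply expands_within_pow.
Qed.

(* The [n]-th coefficient of the [(n+1)]-th fixed-point iterate is final, as
   [a 0 = 0] makes [z |-> e + a z] contracting for the order of vanishing. *)
Lemma PS_fixpoint_ex (a e : nat -> R) :
  a O = 0 -> exists z, forall n, z n = e n + PS_mult a z n.
Proof.
intros Ha.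
set (step := fun z n => e n + PS_mult a z n).
assert (Hstep : forall (n : nat) (z z' : nat -> R),
  (forall k, (k < n)%nat -> z k = z' k) -> step z n = step z' n).
{ intros n z z' H. unfold step, PS_mult. f_equal. apply sum_eq.
  (* The term k = 0 is the only one reading [z n], and its factor [a 0] vanishes. *)
  intros [|k] Hk; [rewrite Ha; ring | f_equal; apply H; lia]. }
set (it := fun m => Nat.iter m step (fun _ => 0)).
assert (Hit : forall n m, (n < m)%nat -> it m n = it (S n) n).
{ intros n; induction n as [n IH] using (well_founded_induction Wf_nat.lt_wf); intros [|m] Hm; [lia|].
  change (step (it m) n = step (it n) n). apply Hstep.
  intros k Hk. rewrite (IH k Hk m), (IH k Hk n) by lia. reflexivity. }
exists (fun n => it (S n) n). intros n.
change (step (it n) n = step (fun n => it (S n) n) n).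
apply Hstep. intros k Hk. now apply Hit.
Qed.

(** The inverse is built as the formal solution of z = 1 + a z; its values then satisfy (1 - F) z =
    1, which also shows that 1 - F has no zero on the segment. *)
Lemma expands_within_inv_1_minus (r : R) (F : C -> C) (U : R) :
  0 < r -> U < 1 -> F (RtoC 0) = RtoC 0 -> expands_within r F U ->
  expands_within r (fun q => / (1 - F q))%C (/ (1 - U)) /\
  forall t, Rabs t < r -> (1 - F (RtoC t))%C <> RtoC 0.
Proof.
intros Hr HU F0 (a & Ha & Sa).
assert (Ha0 : a O = 0).
{ rewrite Sa, PSeries_0 in F0 by (rewrite Rabs_R0; exact Hr).
  now injection F0. }
destruct (PS_fixpoint_ex a (PS_const 1) Ha0) as [z Hz].
assert (HZ : weighted_sums_le r z (/ (1 - U))).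
{ intros N. set (S := sum_f_R0 (fun n => Rabs (z n) * r ^ n) N).
  assert (S0 : 0 <= S)
    by (apply cond_pos_sum; intros; apply weighted_term_ge0; lra).
  (* A finite partial sum can be absorbed on the left since U < 1, so the norm bound comes out
     without presupposing convergence. *)
  assert (HS : S <= 1 + U * S).
  { eapply Rle_trans with (_ + _).
    2: { apply Rplus_le_compat.
         - rewrite <- Rabs_R1. exact (weighted_PS_const r 1 N).
         - eapply Rle_trans;
             [apply (weighted_PS_mult_le r a z N); lra|].
           apply Rmult_le_compat_r; [exact S0 | exact (Ha N)]. }
    unfold S. rewrite <- sum_plus. apply sum_Rle; intros n _.
    rewrite <- Rmult_plus_distr_r. apply Rmult_le_compat_r.
    - apply pow_le; lra.
    - rewrite (Hz n) at 1. apply Rabs_triang. }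
  apply Rmult_le_reg_l with (1 - U); [lra|].
  rewrite Rinv_r by lra. lra. }
assert (HE : forall t, Rabs t < r ->
  ((1 - F (RtoC t)) * RtoC (PSeries z t))%C = RtoC 1).
{ intros t Ht. rewrite Sa by exact Ht.
  rewrite <- RtoC_minus, <- RtoC_mult. f_equal.
  assert (E : PSeries z t = 1 + PSeries a t * PSeries z t).
  { rewrite <- PSeries_mult.
    2: now apply weighted_sums_CV_radius with r U.
    2: now apply weighted_sums_CV_radius with r (/ (1 - U)).
    rewrite <- (PSeries_PS_const 1 t) at 1.
    rewrite <- PSeries_plus.
    - apply PSeries_ext. exact Hz.
    - apply CV_radius_inside.
      apply weighted_sums_CV_radius with r (Rabs 1); [|exact Ht].
      apply weighted_PS_const.
    - apply CV_radius_inside.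
      apply weighted_sums_CV_radius with r (U * / (1 - U)); [|exact Ht].
      intros N. eapply Rle_trans; [apply weighted_PS_mult_le; lra|].
      apply Rmult_le_compat; [| |exact (Ha N)|exact (HZ N)];
        apply cond_pos_sum; intros n; apply weighted_term_ge0; lra. }
  lra. }
assert (HN : forall t, Rabs t < r -> (1 - F (RtoC t))%C <> RtoC 0).
{ intros t Ht K. specialize (HE t Ht). rewrite K, Cmult_0_l in HE.
  injection HE. lra. }
split; [|exact HN].
exists z; split; [exact HZ|]. intros t Ht.
specialize (HE t Ht). specialize (HN t Ht).
transitivity (/ (1 - F (RtoC t)) * ((1 - F (RtoC t)) * RtoC (PSeries z t)))%C.
- now rewrite HE, Cmult_1_r.
- field. exact HN.
Qed.

(** * Inverses of the denominators of the q-continued fraction *)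

Definition HJ_q_tail_inv (cs : list nat) (q : C) : C :=
  match cs with
  | nil => 0
  | _ => / HJ_q cs q
  end%C.

Lemma HJ_q_cons (c : nat) (cs : list nat) (q : C) :
  HJ_q (c :: cs) q = (q_int c q - q ^ (c - 1) * HJ_q_tail_inv cs q)%C.
Proof. destruct cs as [|c' cs]; [cbn; ring | reflexivity]. Qed.

(** Multiplying by 1 - q leaves 1 plus a perturbation of norm r^c, whereas the norm of [q_int c] - 1
    tends to r / (1 - r) = 2/3 at r = 2/5. *)
Lemma q_int_geometric (c : nat) (q : C) :
  ((1 - q) * q_int c q = 1 - q ^ c)%C.
Proof.
induction c as [|c IH]; cbn [q_int Cpow]; [ring|].
rewrite Cmult_plus_distr_l, IH. ring.
Qed.

Lemma expands_within_HJ_q_tail_inv (cs : list nat) :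
  Forall (fun k : nat => (3 < k)%nat) cs ->
  expands_within (2 / 5) (HJ_q_tail_inv cs) (7 / 4).
Proof.
induction cs as [|c cs IH]; intros Hcs.
- apply expands_within_le with (Rabs 0); [rewrite Rabs_R0; lra|].
  apply expands_within_const.
- inversion Hcs as [|? ? Hc Hcs']; subst. specialize (IH Hcs').
  set (u := fun q : C =>
    (q ^ c + (1 - q) * (q ^ (c - 1) * HJ_q_tail_inv cs q))%C).
  assert (H1q : expands_within (2 / 5) (fun q => 1 - q)%C (7 / 5)).
  { apply expands_within_le with (Rabs 1 + 2 / 5); [rewrite Rabs_R1; lra|].
    apply expands_within_minus; [lra | apply expands_within_const|].
    apply expands_within_id; lra. }
  (* The constant is the exact value of the bound at c = 4: 16/625 + 7/5 * 8/125 * 7/4. A larger c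
     only adds the factor (2/5)^(c-4) <= 1. *)
  assert (Hu : expands_within (2 / 5) u (1824 / 10000)).
  { apply expands_within_le with
      ((2 / 5) ^ c + 7 / 5 * ((2 / 5) ^ (c - 1) * (7 / 4))).
    - replace c with (c - 4 + 4)%nat at 1 by lia.
      replace (c - 1)%nat with (c - 4 + 3)%nat by lia.
      rewrite !pow_add.
      pose proof (pow_le (2 / 5) (c - 4) ltac:(lra)).
      assert ((2 / 5) ^ (c - 4) <= 1).
      { rewrite <- (pow1 (c - 4)). apply pow_incr. lra. }
      lra.
    - apply expands_within_plus; [lra | apply expands_within_pow; lra|].
      apply expands_within_mult; [lra | exact H1q|].
      apply expands_within_mult; [lra | apply expands_within_pow; lra | exact IH]. }
  destruct (expands_within_inv_1_minus (2 / 5) u (1824 / 10000))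
    as [Hinv Hne]; [lra | lra | | exact Hu |].
  (* Writing c this way exposes a factor q in both [q ^ c] and [q ^ (c - 1)], so u vanishes at 0. *)
  { unfold u. replace c with (S (S (c - 2))) by lia. cbn. ring. }
  (* This is about 1.712, below 7/4, so the invariant is restored. *)
  apply expands_within_le with (7 / 5 * / (1 - 1824 / 10000)); [lra|].
  apply expands_within_ext with (fun q => (1 - q) * / (1 - u q))%C.
  2: now apply expands_within_mult; [lra| |].
  intros t Ht. specialize (Hne t Ht). cbn [HJ_q_tail_inv].
  assert (E : ((1 - RtoC t) * HJ_q (c :: cs) (RtoC t) = 1 - u (RtoC t))%C).
  { rewrite HJ_q_cons. unfold u.
    transitivity ((1 - RtoC t) * q_int c (RtoC t)
      - (1 - RtoC t) * (RtoC t ^ (c - 1) * HJ_q_tail_inv cs (RtoC t)))%C;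
      [ring|].
    rewrite q_int_geometric. ring. }
  (* As 1 - u is nonzero, so are both factors 1 - t and [HJ_q]; no division by zero occurs on the
     segment. *)
  rewrite <- E in Hne |- *.
  field. split; intros K; apply Hne; rewrite K; ring.
Qed.

(** * From real expansions to complex Taylor series *)

Lemma C_derive_RtoC (F : C -> C) (h : R -> R) (t : R) :
  locally t (fun s => F (RtoC s) = RtoC (h s)) -> ex_derive h t ->
  C_derive F (RtoC t) = RtoC (Derive h t).
Proof.
intros HF Hd.
assert (Hq : forall s, s <> t -> F (RtoC s) = RtoC (h s) ->
  ((F (RtoC s) - F (RtoC t)) / (RtoC s - RtoC t))%C =
  RtoC ((h s - h t) / (s - t))).
{ intros s Hs E. rewrite E, (locally_singleton _ _ HF).
  rewrite <- !RtoC_minus, <- RtoC_div by lra. reflexivity. }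
assert (Hl : is_lim (fun s => (h s - h t) / (s - t)) t (Derive h t)).
{ apply is_lim_spec. intros eps.
  pose proof (proj1 (is_derive_Reals h t _) (Derive_correct _ _ Hd)) as D.
  destruct (D eps (cond_pos eps)) as [delta Hdelta].
  exists delta. intros s Hs Ns.
  specialize (Hdelta (s - t)). rewrite Rplus_minus in Hdelta.
  apply Hdelta; [lra | exact Hs]. }
assert (H' : Rbar_locally' t (fun s =>
  ((F (RtoC s) - F (RtoC t)) / (RtoC s - RtoC t))%C =
  RtoC ((h s - h t) / (s - t)))).
{ destruct HF as [d HF']. exists d. intros s Hs Ns.
  apply Hq; [exact Ns | apply HF'; exact Hs]. }
apply injective_projections.
- change (real (Lim (fun s => fst ((F (RtoC s) - F (RtoC t)) /
    (RtoC s - RtoC t))%C) t) = Derive h t).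
  rewrite (Lim_ext_loc (fun s => (h s - h t) / (s - t))).
  + now rewrite (is_lim_unique _ _ _ Hl).
  + revert H'. apply filter_imp. intros s E.
    now rewrite E.
- change (real (Lim (fun s => snd ((F (RtoC s) - F (RtoC t)) /
    (RtoC s - RtoC t))%C) t) = 0).
  rewrite (Lim_ext_loc (fun s => 0)).
  + now rewrite Lim_const.
  + revert H'. apply filter_imp. intros s E.
    now rewrite E.
Qed.

Lemma C_derive_n_PSeries (r : R) (F : C -> C) (a : nat -> R) :
  (forall t, Rabs t < r -> Rbar_lt (Rabs t) (CV_radius a)) ->
  (forall t, Rabs t < r -> F (RtoC t) = RtoC (PSeries a t)) ->
  forall n t, Rabs t < r ->
    C_derive_n F n (RtoC t) = RtoC (Derive_n (PSeries a) n t).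
Proof.
intros Hr HF n. induction n as [|n IH]; intros t Ht; [now apply HF|].
apply C_derive_RtoC.
(* Differentiating once more needs the previous identity near t, which the ball of radius r - |t|
   supplies. *)
- assert (d_pos : 0 < r - Rabs t) by lra.
  exists (mkposreal _ d_pos). intros s Hs. apply IH.
  change (Rabs (s - t) < r - Rabs t) in Hs.
  pose proof (Rabs_triang t (s - t)) as T. rewrite Rplus_minus in T. lra.
- apply (ex_derive_n_PSeries (S n)). now apply Hr.
Qed.

Lemma taylor_coef_expands (r : R) (F : C -> C) (a : nat -> R) (B : R) :
  0 < r -> weighted_sums_le r a B ->
  (forall t, Rabs t < r -> F (RtoC t) = RtoC (PSeries a t)) ->
  forall n, taylor_coef F n = RtoC (a n).
Proof.
intros Hr Ha HF n. unfold taylor_coef.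
assert (H0 : Rabs 0 < r) by now rewrite Rabs_R0.
rewrite (C_derive_n_PSeries r F a);
  [|now intros; apply weighted_sums_CV_radius with r B | exact HF | exact H0].
rewrite Derive_n_coef.
- pose proof (INR_fact_neq_0 n). rewrite <- RtoC_div by assumption.
  f_equal. field. assumption.
- rewrite <- Rabs_R0. now apply weighted_sums_CV_radius with r B.
Qed.

Lemma ex_pseries_RtoC (a : nat -> R) (r : R) :
  ex_pseries a r ->
  @ex_pseries C_AbsRing C_NormedModule (fun n => RtoC (a n)) (RtoC r).
Proof.
intros [l Hl]. exists (RtoC l).
apply filterlim_ext with (fun n =>
  RtoC (sum_n (fun k => scal (pow_n r k) (a k)) n)).
- intros n. induction n as [|n IH].
  + rewrite !sum_O. apply injective_projections; cbn; ring.
  + rewrite !sum_Sn, <- IH, !pow_n_pow.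
    assert (E : @pow_n C_Ring (RtoC r) (S n) = RtoC (r ^ S n)).
    { rewrite RtoC_pow. generalize (S n). intros m.
      induction m as [|m IHm]; [reflexivity|].
      cbn [pow_n Cpow]. now rewrite IHm. }
    transitivity (RtoC (sum_n (fun k => scal (pow_n r k) (a k)) n) +
      @pow_n C_Ring (RtoC r) (S n) * RtoC (a (S n)))%C; [|reflexivity].
    rewrite E, <- RtoC_mult, <- RtoC_plus. reflexivity.
- apply filterlim_comp with (1 := Hl).
  intros P [eps HP]. exists eps. intros y Hy. apply HP.
  (* Balls of [C] are products of real balls, and both imaginary parts are 0. *)
  split; [exact Hy | apply ball_center].
Qed.

(** * Comparison of radii and conclusion *)

Lemma R_star_lt_two_fifths : R_star < 2 / 5.
Proof.
unfold R_star.
(* The threshold solves (3 - s) / 2 = 2/5, and 2.2^2 = 4.84 < 5. *)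
assert (22 / 10 < sqrt 5); [|lra].
rewrite <- (sqrt_pow2 (22 / 10)) by lra. apply sqrt_lt_1; lra.
Qed.

Theorem theorem1p3 (x : Q) (c : list nat)
  (hx : is_HJ_expansion x c)
  (hc : Forall (fun k : nat => (3 < k)%nat) c) :
  Rbar_lt (Finite R_star) (C_CV_radius (taylor_coef (q_rational x))).
Proof.
unfold q_rational. rewrite (HJ_expansion_eq x c hx).
destruct hx as [hadm _]. destruct c as [|c1 cs]; [easy|].
inversion hc as [|? ? _ Hcs]; subst.
(* The outermost level is not inverted, so any finite norm suffices here. *)
destruct (expands_within_q_int (2 / 5) c1) as [B HB]; [lra|].
assert (HF : expands_within (2 / 5) (HJ_q (c1 :: cs))
  (B + (2 / 5) ^ (c1 - 1) * (7 / 4))).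
{ apply expands_within_ext with
    (fun q => q_int c1 q - q ^ (c1 - 1) * HJ_q_tail_inv cs q)%C.
  - intros t _. now rewrite HJ_q_cons.
  - apply expands_within_minus; [lra | exact HB |].
    apply expands_within_mult; [lra | apply expands_within_pow; lra|].
    now apply expands_within_HJ_q_tail_inv. }
destruct HF as (a & Ha & Sa).
(* Convergence at the point 2/5 itself gives a radius >= 2/5; strictness comes from [R_star] <
   2/5. *)
apply Rbar_lt_le_trans with (2 / 5); [exact R_star_lt_two_fifths|].
apply (proj1 (Lub_Rbar_correct _)).
exists (RtoC (2 / 5)). split.
- rewrite Cmod_R, Rabs_pos_eq; lra.
- destruct (ex_pseries_RtoC a (2 / 5)) as [l Hl].
  + apply CV_disk_correct. eapply weighted_sums_CV_disk; [lra | exact Ha].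
  + exists l. revert Hl. apply is_series_ext. intros n.
    f_equal. symmetry. eapply taylor_coef_expands; [|exact Ha|exact Sa]. lra.
Qed.
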